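(* Let $g^-(u) = 0$ and $g^+(u) = b$ for $0 \leq u \leq 1$, where $b>0$. Then the diffusion house-moving $H_{\mu}^{0 \to b}:=H_\mu^{g^-\to g^+}$ has the space-time reversal property $$P( H_{\mu}^{0 \to b}(t) \in dy ) = P( H_{\mu}^{0 \to b}(1-t) \in b - dy )\qquad (0<t<1,\ 0<y<b)$$ if and only if $$\begin{aligned} &E[e^{-\frac{1}{2}N_{[0,t]}(W_{[0,t]}^{0,y,(0,b)})}]\, E[e^{-\frac{1}{2}N_{[t,1]}(W_{[t,1]}^{y,b,(0,b)})}] \\ &= E[e^{-\frac{1}{2}N_{[0,1-t]}(W_{[0,1-t]}^{0,b-y,(0,b)})}]\, E[e^{-\frac{1}{2}N_{[1-t,1]}(W_{[1-t,1]}^{b-y,b,(0,b)})}] \qquad (0<t<1,\ 0<y<b). \end{aligned}$$ In particular, if $\mu$ is constant, then $H_{\mu}^{0 \to b}$ has the space-time reversal property.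
   Context: $C([s,t],\mathbb{R})$ carries the sup metric. $K_{[s,t]}(f,g):=\{w\in C([s,t],\mathbb{R}): f(u)\le w(u)\le g(u),\ s\le u\le t\}$, $K=K_{[0,1]}$. For a path-valued random variable $Y$ and Borel $\Lambda$ with $P(Y\in\Lambda)>0$, $Y\vert_\Lambda$ denotes $Y$ conditioned on $\{Y\in\Lambda\}$. $\eta^\pm(\varepsilon)>0$ for $\varepsilon>0$ and $\eta^\pm(\varepsilon)\downarrow0$ as $\varepsilon\downarrow0$. $\mu:\mathbb{R}\to\mathbb{R}$ is $C^1$; $X=\{X(t)\}_{t\ge0}$ is the one-dimensional time-homogeneous diffusion satisfying $dX(t)=\mu(X(t))dt+dW(t)$, $X(0)=0$, $W$ a standard Brownian motion; $X_{[0,1]}^{0\to b}$ is the $X$-bridge from $0$ to $b$ on $[0,1]$. $W_{[s,t]}^{\alpha\to\beta}$ is the Brownian bridge from $\alpha$ to $\beta$ on $[s,t]$. $N_{[s,t]}(w):=\int_s^t\{\mu'(w(u))+\mu^2(w(u))\}du$. Constant curves $g^-\equiv0$, $g^+\equiv b$: for $0<y<b$ and $0<t<1$, $W_{[0,t]}^{0,y,(0,b)}$ (resp. $W_{[t,1]}^{y,b,(0,b)}$) is the weak limit (known to exist) as $\varepsilon\downarrow0$ of $W_{[0,t]}^{0\to y}\vert_{K_{[0,t]}(-\varepsilon,b+\varepsilon)}$ (resp. $W_{[t,1]}^{y\to b}\vert_{K_{[t,1]}(-\varepsilon,b+\varepsilon)}$). The Brownian house-moving $H^{0\to b}$ is the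 weak limit (known to exist) of $W_{[0,1]}^{0\to b}\vert_{K(-\eta^-(\varepsilon),b+\eta^+(\varepsilon))}$ as $\varepsilon\downarrow0$. The diffusion house-moving $H_\mu^{0\to b}$ is the continuous Markov process on $[0,1]$ which is the weak limit of $X_{[0,1]}^{0\to b}\vert_{K(-\eta^-(\varepsilon),b+\eta^+(\varepsilon))}$ as $\varepsilon\downarrow0$; equivalently $E[F(H_\mu^{0\to b})]=E[e^{-\frac12N_{[0,1]}(H^{0\to b})}F(H^{0\to b})]/E[e^{-\frac12N_{[0,1]}(H^{0\to b})}]$ for bounded continuous $F$. Convention: $P(H_\mu^{0\to b}(t)\in dy)$ is understood through the density $$h_\mu(t,y)=\frac{E[e^{-\frac12N_{[0,t]}(W_{[0,t]}^{0,y,(0,b)})}]\,E[e^{-\frac12N_{[t,1]}(W_{[t,1]}^{y,b,(0,b)})}]}{E[e^{-\frac12N_{[0,1]}(H^{0\to b})}]}\,h(t,y),\qquad 0<t<1,\ 0<y<b,$$ so the reversal property means $h_\mu(t,y)=h_\mu(1-t,b-y)$. Here $h(t,y)$ is the density of $H^{0\to b}(t)$, given by $$h(t,y)=\frac{1}{C}\frac1{\sqrt t}\,q_t(y)\,\frac1{\sqrt{1-t}}\,q_{1-t}(b-y),\qquad q_s(z):=P\big(R_{[0,s]}^{0\to z}\in K^-_{[0,s]}(b)\big)\frac{P(W^+_{[0,s]}(s)\in dz)}{dz},$$ where $R_{[0,s]}^{0\to z}$ is the BES(3)-bridge from $0$ to $z$ on $[0,s]$, $W^+_{[0,s]}$ the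 Brownian meander on $[0,s]$, $K^-_{[0,s]}(b)=\{w\in C([0,s],\mathbb{R}):w\le b\}$, and $$C=\frac{\pi}{2}\frac{e^{-b^2/2}}{\sqrt{2\pi}}\lim_{\varepsilon\downarrow0}\frac{P(W_{[0,1]}^{0\to b}\in K(-\eta^-(\varepsilon),b+\eta^+(\varepsilon)))}{\eta^-(\varepsilon)\eta^+(\varepsilon)}.$$ *)

(* Defs.v *)
From HB Require Import structures.
From mathcomp Require Import all_boot all_order all_algebra.
From mathcomp Require Import all_classical all_reals all_analysis.

Import Order.TTheory GRing.Theory Num.Theory.
Import numFieldNormedType.Exports.

Local Open Scope classical_set_scope.
Local Open Scope ring_scope.

(* The space C([s, t], R) is represented by the functions R -> R that are      *)
(* continuous on [s, t], with the topology of uniform convergence on [s, t];   *)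
(* values outside [s, t] are topologically invisible, so they never matter.    *)
Section PathSpace.
Context {R : realType}.

Definition paths (s t : R) : set {uniform` `[s, t]%classic -> R} :=
  [set w | {within `[s, t]%classic, continuous (w : R -> R)}].

Definition bounded_continuous (s t : R) (F : {uniform` `[s, t]%classic -> R} -> R) :=
  {within paths s t, continuous F} /\
  exists M : R, forall w, paths s t w -> `|F w| <= M.

Definition K (s t : R) (f g : R -> R) : set (R -> R) :=
  [set w | paths s t w /\ forall u, s <= u <= t -> f u <= w u <= g u].

Definition Kle (s t b : R) : set (R -> R) :=
  [set w | paths s t w /\ forall u, s <= u <= t -> w u <= b].

Definition C1 (m : R -> R) := (forall x, derivable m x 1) /\ continuous (derive1 m).

Definition N (mu : R -> R) (s t : R) (w : R -> R) : R :=
  \int[lebesgue_measure]_(u in `[s, t]) (derive1 mu (w u) + mu (w u) ^+ 2).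

End PathSpace.

(* A stochastic process is Y : T -> R -> R, with Y omega u its value at time u. *)
Section Processes.
Context {d : measure_display} {T : measurableType d} {R : realType}.
Variable P : probability T R.

Definition Ex (X : T -> R) : R := fine ('E_P[X])%E.

Definition Pr (A : set T) : R := fine (P A).

Definition random_path (s t : R) (Y : T -> R -> R) :=
  (forall omega, paths s t (Y omega)) /\
  (forall u, s <= u <= t -> measurable_fun setT (Y ^~ u)).

(* E[F(Y)] for Y conditioned on {Y \in L} *)
Definition condEx (Y : T -> R -> R) (L : set (R -> R)) (F : (R -> R) -> R) : R :=
  Ex (fun omega => F (Y omega) * \1_L (Y omega)) / Pr [set omega | L (Y omega)].

(* Z is the weak limit in C([s, t], R), as e decreases to 0, of Y conditioned  *)
(* on {Y \in L e}. Taking F = 1 shows that P(Y \in L e) > 0 for all small e.   *)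
Definition weak_limit (s t : R) (Y : T -> R -> R) (L : R -> set (R -> R))
    (Z : T -> R -> R) :=
  random_path s t Z /\
  forall F : {uniform` `[s, t]%classic -> R} -> R, bounded_continuous s t F ->
    condEx Y (L e) F @[e --> 0^'+] --> Ex (fun omega => F (Z omega)).

(* n-dimensional standard Brownian motion: the product formula expresses both  *)
(* the normality of the increments and their joint independence, over time     *)
(* and over the coordinates.                                                   *)
Definition brownian_motion (n : nat) (B : 'I_n -> T -> R -> R) :=
  [/\ forall k omega, B k omega 0 = 0,
      forall k omega, {within `[0, +oo[%classic, continuous (B k omega)},
      forall k u, 0 <= u -> measurable_fun setT (B k ^~ u) &
      forall (m : nat) (t : nat -> R) (A : 'I_n -> 'I_m -> set R),
        0 <= t 0%N -> (forall i, (i < m)%N -> t i < t i.+1) ->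
        (forall k i, measurable (A k i)) ->
        P [set omega | forall k (i : 'I_m),
             A k i (B k omega (t i.+1) - B k omega (t i))] =
        (\prod_(k < n) \prod_(i < m)
           normal_prob 0 (Num.sqrt (t i.+1 - t i)) (A k i))%E].

Definition bridge (W : T -> R -> R) (s t alpha beta : R) (omega : T) (u : R) : R :=
  alpha + (W omega u - W omega s)
  + (u - s) / (t - s) * ((beta - alpha) - (W omega t - W omega s)).

(* Norm of the three-dimensional Brownian bridge from 0 to (z, 0, 0) on [0, s]. *)
Definition bes3_bridge (B : 'I_3 -> T -> R -> R) (s z : R) (omega : T) (u : R) : R :=
  Num.sqrt (\sum_(k < 3)
    bridge (B k) 0 s 0 (if k == ord0 then z else 0) omega u ^+ 2).

(* P(|Z| < y) for Z normal with variance r; normal_prob is not the Dirac mass  *)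
(* when its standard deviation is 0, hence the case distinction.               *)
Definition abs_normal (r y : R) : R :=
  if r == 0 then 1 else fine (normal_prob 0 (Num.sqrt r) `]- y, y[%classic).

(* Transition density of the Brownian meander on [0, s], from x at time u to   *)
(* y > 0 at time v (u < v <= s); the case u = 0 is the entrance density from 0. *)
Definition meander_density (s u x v y : R) : R :=
  if u == 0 then
    Num.sqrt (2 * pi * s) * (y / v) * normal_pdf 0 (Num.sqrt v) y
    * abs_normal (s - v) y
  else
    (normal_pdf x (Num.sqrt (v - u)) y - normal_pdf (- x) (Num.sqrt (v - u)) y)
    * abs_normal (s - v) y / abs_normal (s - u) x.

(* Iterated integral giving the law of (Y(t_0), ..., Y(t_(n-1))) on the         *)
(* rectangle A_0 x ... x A_(n-1), for a Markov process on (0, +oo) with         *)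
(* transition density p and Y(u) = x.                                          *)
Fixpoint markov_fdd (p : R -> R -> R -> R -> R) (n : nat) (u x : R)
    (t : nat -> R) (A : nat -> set R) : \bar R :=
  if n is n'.+1 then
    (\int[lebesgue_measure]_(y in A 0%N `&` `]0%R, +oo[)
       ((p u x (t 0%N) y)%:E * markov_fdd p n' (t 0%N) y (t \o succn) (A \o succn)))%E
  else 1%E.

Definition brownian_meander (s : R) (M : T -> R -> R) :=
  [/\ random_path 0 s M,
      forall omega, M omega 0 = 0 &
      forall (n : nat) (t : nat -> R) (A : nat -> set R),
        (forall i, (i < n)%N -> 0 < t i <= s) ->
        (forall i, (i.+1 < n)%N -> t i < t i.+1) ->
        (forall i, measurable (A i)) ->
        P [set omega | forall i, (i < n)%N -> A i (M omega (t i))] =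
        markov_fdd (meander_density s) n 0 0 t A].

(* P(X \in dz) / dz, as the derivative of the distribution function. *)
Definition density_at (X : T -> R) (z : R) : R :=
  derive1 (fun x : R => Pr [set omega | X omega <= x]) z.

Definition diffusion (mu : R -> R) (W X : T -> R -> R) :=
  [/\ forall omega, {within `[0, +oo[%classic, continuous (X omega)},
      forall u, 0 <= u -> measurable_fun setT (X ^~ u) &
      forall omega t, 0 <= t ->
        X omega t = \int[lebesgue_measure]_(u in `[0, t]) mu (X omega u)
                    + W omega t].

(* The X-bridge on [0, 1] ending at b is X conditioned on {X(1) = b}, the       *)
(* conditioning on this null event being the limit of {|X(1) - b| <= e}.       *)
Definition diffusion_bridge (b : R) (X Z : T -> R -> R) :=
  weak_limit 0 1 X (fun e => [set w | `|w 1 - b| <= e]) Z.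

(* Y conditioned to the strip between - em(e) and b + ep(e), e decreasing to 0 *)
Definition house_moving (b : R) (em ep : R -> R) (Y Z : T -> R -> R) :=
  weak_limit 0 1 Y (fun e => K 0 1 (fun=> - em e) (fun=> b + ep e)) Z.

(* Here B is a three-dimensional Brownian motion, B ord0 plays the role of W,  *)
(* and Wp s is a Brownian meander on [0, s].                                   *)
Definition house_q (B : 'I_3 -> T -> R -> R) (Wp : R -> T -> R -> R)
    (b s z : R) : R :=
  Pr [set omega | Kle 0 s b (bes3_bridge B s z omega)]
  * density_at (fun omega => Wp s omega s) z.

Definition house_const (W : T -> R -> R) (em ep : R -> R) (b : R) : R :=
  pi / 2 * (expR (- (b ^+ 2 / 2)) / Num.sqrt (2 * pi))
  * lim (Pr [set omega | K 0 1 (fun=> - em e) (fun=> b + ep e)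
                           (bridge W 0 1 0 b omega)]
         / (em e * ep e) @[e --> 0^'+]).

Definition house_density (B : 'I_3 -> T -> R -> R) (Wp : R -> T -> R -> R)
    (em ep : R -> R) (b t y : R) : R :=
  (house_const (B ord0) em ep b)^-1
  * ((Num.sqrt t)^-1 * house_q B Wp b t y)
  * ((Num.sqrt (1 - t))^-1 * house_q B Wp b (1 - t) (b - y)).

Definition Eexp (mu : R -> R) (s t : R) (Y : T -> R -> R) : R :=
  Ex (fun omega => expR (- (1 / 2) * N mu s t (Y omega))).

Definition dhouse_density (mu : R -> R) (B : 'I_3 -> T -> R -> R)
    (Wp : R -> T -> R -> R) (em ep : R -> R)
    (WL WR : R -> R -> T -> R -> R) (H : T -> R -> R) (b t y : R) : R :=
  Eexp mu 0 t (WL t y) * Eexp mu t 1 (WR t y) / Eexp mu 0 1 H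
  * house_density B Wp em ep b t y.

(* The law of Z(t) is f(t, y) dy on (0, b), for every 0 < t < 1. *)
Definition has_density (b : R) (Z : T -> R -> R) (f : R -> R -> R) :=
  forall t : R, 0 < t < 1 -> forall A : set R, measurable A ->
    P [set omega | A (Z omega t)] =
    (\int[lebesgue_measure]_(y in A `&` `]0%R, b[) (f t y)%:E)%E.

(* P(Z(t) \in dy) = P(Z(1 - t) \in b - dy), the laws of Z(t) being understood  *)
(* through the given version f(t, .) of their densities on (0, b).             *)
Definition space_time_reversal (b : R) (Z : T -> R -> R) (f : R -> R -> R) :=
  has_density b Z f /\
  forall t y : R, 0 < t < 1 -> 0 < y < b -> f t y = f (1 - t) (b - y).

End Processes.

(* Main.v *)
Require Import Defs.
From HB Require Import structures.
From mathcomp Require Import all_boot all_order all_algebra.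
From mathcomp Require Import all_classical all_reals all_analysis.
From mathcomp Require Import measurable_realfun.
From mathcomp Require Import ring lra.
Import Order.TTheory GRing.Theory Num.Theory.
Import numFieldNormedType.Exports.
Local Open Scope classical_set_scope.
Local Open Scope ring_scope.

(** The density of the diffusion house-moving at (t, y) is
      E_left(t, y) * E_right(t, y) / E(H) * h(t, y),
    where h is the density of the Brownian house-moving. The map
    (t, y) |-> (1 - t, b - y) exchanges the two factors q_t(y) / sqrt t and
    q_(1-t)(b - y) / sqrt (1 - t) of h, so h is symmetric under it. Hence
    reversal of the full density is equivalent to reversal of
    E_left * E_right, as soon as E(H)^-1 and h(t, y) can be cancelled, that is,
    do not vanish. If mu is a constant c then the two exponents add up to
    - c ^ 2 / 2 for every t, and the condition holds trivially.

    That E(H)^-1 and the normalising constant of h are nonzero follows from the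
    two given functions being densities, since they cannot be identically 0
    ([has_density_neq0]). The substance is the positivity of q_s(z) for all
    0 < z < b, at every point and not just almost everywhere
    ([house_q_gt0]). It has two factors. The endpoint density of the meander is
    explicit ([meander_end_density]). The probability that the BES(3)-bridge
    from 0 to z stays below b is positive ([Kle_bes3_gt0]) because it contains
    the event that a three-dimensional Brownian motion stays in a small ball
    on [0, s].

    The small ball estimate ([small_ball_event]) is obtained by cutting
    [0, s] into nb blocks. In each block and coordinate the path is required to
    stay within e / 2 of its initial value and to return to within e / (2 nb) of
    it; all these requirements together keep the path within e of the origin.
    Over a block of length s / nb, the return has probability of order
    nb ^ (-1/2) ([normal_center]), whereas an excursion of size e / 2 has
    probability O(1 / nb), by Ottaviani's inequality ([ottaviani]) and a tail
    bound for the normal law ([normal_tail]). So for nb large both requirements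
    hold together with some probability p > 0 ([small_block]). The blocks
    and coordinates being independent ([independent_cylinders]), the path stays
    near the origin with probability at least a power of p. Everything is done
    on a grid with L steps per block, with bounds independent of L; letting the
    mesh go to 0 concludes by continuity of the paths and of the measure. *)

(** * Level sets of measurable functions *)

Section LevelSets.
Context {d : measure_display} {T : measurableType d} {R : realType}.
Variables (f : T -> R) (c : R).
Hypothesis mf : measurable_fun setT f.

Lemma measurable_le_cst : measurable [set x | f x <= c].
Proof.
rewrite -[X in measurable X]setTI.
by apply: (measurable_fun_le _ mf (measurable_cst c)).
Qed.

End LevelSets.

Section AbsoluteLevelSets.
Context {d : measure_display} {T : measurableType d} {R : realType}.
Variables (f : T -> R) (c : R).
Hypothesis mf : measurable_fun setT f.

Lemma measurable_normr_le : measurable [set x | `|f x| <= c].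
Proof. by apply: measurable_le_cst; apply: measurableT_comp. Qed.

Lemma normr_gtE : [set x | c < `|f x|] = ~` [set x | `|f x| <= c].
Proof. by apply/seteqP; split => x /=; rewrite real_ltNge ?num_real// => /negP. Qed.

Lemma measurable_normr_gt : measurable [set x | c < `|f x|].
Proof. by rewrite normr_gtE; exact/measurableC/measurable_normr_le. Qed.

End AbsoluteLevelSets.

(** * Independence of sigma-algebras generated by disjoint families *)

Section Independence.
Context {d : measure_display} {T : measurableType d} {R : realType}.
Variable P : probability T R.

(** One half of the extension of independence from pi-systems to the generated
    sigma-algebras: for fixed F, the events E independent of F form a Dynkin
    system. *)
Lemma independent_sigma1 (G : set (set T)) (F : set T) :
  setI_closed G -> G `<=` measurable -> measurable F ->
  (forall E, G E -> P (E `&` F) = (P E * P F)%E) ->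
  forall E, <<s G >> E -> measurable E /\ P (E `&` F) = (P E * P F)%E.
Proof.
move=> GI Gm mF GF.
have Pfin A : measurable A -> P A \is a fin_num by exact: fin_num_measure.
apply: (lambda_system_subset GI) => //; last by move=> E GE; split; auto.
apply/dynkin_lambda_system; split.
- by split; [exact: measurableT|rewrite setTI probability_setT mul1e].
- move=> E [mE PE]; split; first exact: measurableC.
  have -> : P (~` E `&` F) = (P F - P E * P F)%E.
    rewrite setIC -setDE measureD//; last by rewrite -ge0_fin_numE// Pfin.
    by rewrite -PE (setIC E).
  by rewrite probability_setC// muleBl ?mul1e ?Pfin// fin_num_adde_defr// Pfin.
- move=> A tA mA; have mA' n : measurable (A n) by case: (mA n).
  split; first exact: bigcup_measurable.
  rewrite setI_bigcupl measure_bigcup//=; last 2 first.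
  + by move=> n _; apply: measurableI.
  + exact: trivIset_setIr.
  under eq_eseriesr do rewrite (mA _).2 muleC.
  rewrite -(fineK (Pfin F mF)) nneseriesZl//.
  by rewrite -measure_bigcup// muleC.
Qed.

Lemma independent_sigma (G1 G2 : set (set T)) :
  setI_closed G1 -> setI_closed G2 ->
  G1 `<=` measurable -> G2 `<=` measurable ->
  (forall E F, G1 E -> G2 F -> P (E `&` F) = (P E * P F)%E) ->
  forall E F, <<s G1 >> E -> <<s G2 >> F -> P (E `&` F) = (P E * P F)%E.
Proof.
move=> G1I G2I G1m G2m indep E F G1E G2F.
have [mE _] : measurable E /\ P (E `&` setT) = (P E * P setT)%E.
  apply: (independent_sigma1 G1 setT) => // A _.
  by rewrite setIT probability_setT mule1.
rewrite setIC muleC; apply: (independent_sigma1 G2 E _ _ _ _ F G2F).2 => //.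
move=> A G2A; rewrite setIC muleC.
by apply: (independent_sigma1 G1 A _ _ _ _ E G1E).2 => //; [exact: G2m|auto].
Qed.

Context {I : finType} (X : I -> T -> R).

(** Events that constrain finitely many variables separately: a pi-system
    generating the sigma-algebra of the variables X i with i in J. *)
Definition cylinders (J : pred I) : set (set T) :=
  [set E | exists2 A : I -> set R, forall i, measurable (A i) &
    E = [set omega | forall i, J i -> A i (X i omega)]].

Hypothesis mX : forall i, measurable_fun setT (X i).

Lemma measurable_rectangle (A : I -> set R) (J : pred I) :
  (forall i, measurable (A i)) ->
  measurable [set omega | forall i, J i -> A i (X i omega)].
Proof.
move=> mA.
rewrite (_ : mkset _ = \bigcap_(i in [set i | J i]) X i @^-1` A i).
  by apply: fin_bigcap_measurable => // i _; rewrite -[X in measurable X]setTI; apply: mX.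
by apply/seteqP; split => omega /=.
Qed.

Lemma cylinders_setI_closed (J : pred I) : setI_closed (cylinders J).
Proof.
move=> _ _ [A mA ->] [A' mA' ->]; exists (fun i => A i `&` A' i).
  by move=> i; exact: (measurableI _ _ (mA i) (mA' i)).
apply/seteqP; split => omega /=.
  by move=> [h h'] i Ji; split; [exact: h|exact: h'].
by move=> h; split => i Ji; have [] := h i Ji.
Qed.

Lemma sub_cylinders (J J' : pred I) : {subset J <= J'} ->
  cylinders J `<=` cylinders J'.
Proof.
move=> JJ' _ [A mA ->]; exists (fun i => if J i then A i else setT).
  by move=> i; case: ifP.
apply/seteqP; split => omega /= h i.
  by case: ifPn => // Ji _; exact: h.
by move=> Ji; have := h i (JJ' _ Ji); rewrite Ji.
Qed.

Hypothesis indep : forall A : I -> set R, (forall i, measurable (A i)) ->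
  P [set omega | forall i, A i (X i omega)] =
  (\prod_(i : I) P (X i @^-1` A i))%E.

Let rectangleE (A : I -> set R) (J : pred I) : (forall i, measurable (A i)) ->
  P [set omega | forall i, J i -> A i (X i omega)] =
  (\prod_(i : I) P (X i @^-1` (if J i then A i else setT)))%E.
Proof.
move=> mA; rewrite -indep; last by move=> i; case: ifP.
congr (P _); apply/seteqP; split => omega /= h i.
  by case: ifPn => // Ji; exact: h.
by move=> Ji; have := h i; rewrite Ji.
Qed.

(** Product formulas for rectangles already contain full independence: any event
    built from one group of the variables, however complicated, is independent
    of any event built from the others. *)
Lemma independent_cylinders (J : pred I) E F :
  <<s cylinders J >> E -> <<s cylinders (predC J) >> F ->
  P (E `&` F) = (P E * P F)%E.
Proof.
have cylm J' : cylinders J' `<=` measurable.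
  by move=> _ [A mA ->]; exact: (measurable_rectangle A J' mA).
have cylI := cylinders_setI_closed.
apply: (independent_sigma _ _ (cylI J) (cylI (predC J)) (cylm _) (cylm _)).
move=> _ _ [A mA ->] [A' mA' ->].
rewrite !rectangleE// -big_split/=.
rewrite (_ : _ `&` _ = [set omega | forall i, (if J i then A i else A' i) (X i omega)]).
  rewrite (indep (fun i => if J i then A i else A' i)); last by move=> i; case: ifP.
  apply: eq_bigr => i _; case: (J i) => /=;
  by rewrite preimage_setT probability_setT ?mule1 ?mul1e.
apply/seteqP; split => omega /=.
  by move=> [h h'] i; case: ifPn => Ji; [exact: h|exact: h'].
by move=> h; split => i Ji; have := h i; rewrite ?Ji// (negbTE Ji).
Qed.

End Independence.

(** * Estimates on the centred normal law *)

Section NormalEstimates.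
Context {R : realType}.

Lemma normal_pdf_scale2 (s x : R) : 0 < s ->
  normal_pdf 0 s x = 2 * expR (- (3 / 8 * (x / s) ^+ 2)) * normal_pdf 0 (2 * s) x.
Proof.
move=> s0; rewrite !normal_pdfE ?gt_eqF ?mulr_gt0//.
have -> : normal_peak (2 * s) = normal_peak s / 2.
  rewrite /normal_peak -invfM; congr (_^-1).
  have -> : (2 * s) ^+ 2 * pi *+ 2 = 2 ^+ 2 * (s ^+ 2 * pi *+ 2) by ring.
  by rewrite sqrtrM ?sqr_ge0// sqrtr_sqr ger0_norm// mulrC.
rewrite [RHS](_ : _ = normal_peak s * (expR (- (3 / 8 * (x / s) ^+ 2)) * normal_fun 0 (2 * s) x)).
  congr (_ * _); rewrite /normal_fun -expRD; congr expR.
  by field; rewrite gt_eqF.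
by field.
Qed.

(** Doubling the standard deviation in the density costs an exponential factor,
    which on the tail is at most a multiple of s ^ 2 / c ^ 2; the wider normal
    law has total mass 1. *)
Lemma normal_tail (s c : R) : 0 < s -> 0 < c ->
  (normal_prob 0 s [set x | c < `|x|]%R <= (6 * s ^+ 2 / c ^+ 2)%:E)%E.
Proof.
move=> s0 c0; rewrite /normal_prob.
have mA : measurable [set x : R | c < `|x|] by exact: (measurable_normr_gt id).
pose k := 6 * s ^+ 2 / c ^+ 2.
have k0 : 0 <= k by rewrite divr_ge0 ?sqr_ge0// mulr_ge0 ?sqr_ge0.
apply: (@le_trans _ _ (\int[lebesgue_measure]_(x in [set x | c < `|x|]%R)
    (k%:E * (normal_pdf 0 (2 * s) x)%:E))%E).
  apply: ge0_le_integral => //.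
  - by move=> x _; rewrite lee_fin normal_pdf_ge0.
  - by apply: measurable_funTS; apply/measurable_EFinP; exact: measurable_normal_pdf.
  - apply: measurable_funTS; apply/measurable_EFinP.
    by apply: measurable_funM; [exact: measurable_cst|exact: measurable_normal_pdf].
  - move=> x /= cx; rewrite -EFinM lee_fin normal_pdf_scale2//.
    apply: ler_wpM2r; first exact: normal_pdf_ge0.
    have x2 : c ^+ 2 <= x ^+ 2.
      by rewrite -(real_normK (num_real x)) ler_sqr ?nnegrE// ltW.
    rewrite expRN.
    have y0 : 0 < 3 / 8 * (c / s) ^+ 2 by rewrite mulr_gt0// exprn_gt0// divr_gt0.
    have le1 : 3 / 8 * (c / s) ^+ 2 <= expR (3 / 8 * (x / s) ^+ 2).
      apply: (@le_trans _ _ (3 / 8 * (x / s) ^+ 2)).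
        by rewrite ler_pM2l// !expr_div_n ler_pM2r// invr_gt0 exprn_gt0.
      by apply: le_trans (expR_ge1Dx _); lra.
    apply: (@le_trans _ _ (2 * (3 / 8 * (c / s) ^+ 2)^-1)).
      by rewrite ler_pM2l// lef_pV2// posrE// expR_gt0.
    have -> : 2 * (3 / 8 * (c / s) ^+ 2)^-1 = 16 / 3 * (s ^+ 2 / c ^+ 2).
      by field; rewrite !gt_eqF.
    rewrite /k -[leRHS]mulrA; apply: ler_wpM2r; last lra.
    by rewrite divr_ge0// sqr_ge0.
rewrite ge0_integralZl//; last 2 first.
- by apply: measurable_funTS; apply/measurable_EFinP; exact: measurable_normal_pdf.
- by move=> x _; rewrite lee_fin normal_pdf_ge0.
rewrite -[leRHS]mule1; apply: lee_wpmul2l; first by rewrite lee_fin.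
rewrite -(integral_normal_pdf 0 (2 * s)).
apply: ge0_subset_integral => //.
  by apply/measurable_EFinP; exact: measurable_normal_pdf.
by move=> x _; rewrite lee_fin normal_pdf_ge0.
Qed.

Lemma normal_center (s c : R) : 0 < s -> 0 < c ->
  ((2 * c * normal_pdf 0 s c)%:E <= normal_prob 0 s [set x | `|x| <= c]%R)%E.
Proof.
move=> s0 c0; rewrite /normal_prob.
rewrite (_ : [set x | _] = `[- c, c]%classic); last first.
  by apply/seteqP; split => x /=; rewrite in_itv/= ler_norml.
have -> : ((2 * c * normal_pdf 0 s c)%:E =
    \int[lebesgue_measure]_(x in `[(- c)%R, c]) (normal_pdf 0 s c)%:E)%E.
  rewrite integral_cst//= lebesgue_measure_itv/= lte_fin ifT; last lra.
  by rewrite -EFinD -EFinM; congr (_%:E); ring.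
apply: ge0_le_integral => //.
- by move=> x _; rewrite lee_fin normal_pdf_ge0.
- by apply: measurable_funTS; apply/measurable_EFinP; exact: measurable_normal_pdf.
- move=> x; rewrite /= in_itv/= => xc; rewrite lee_fin !normal_pdfE ?gt_eqF//.
  apply: ler_wpM2l; first exact: normal_peak_ge0.
  rewrite /normal_fun ler_expR !subr0 !mulNr lerN2 ler_pM2r.
    by rewrite -(real_normK (num_real x)) ler_sqr ?nnegrE ?ler_norml// ltW.
  by rewrite invr_gt0 pmulrn_lgt0// exprn_gt0.
Qed.

(** Cutting [0, s] into n blocks, a Brownian path comes back to within e / (2 n)
    of its starting point over one block with probability of order n ^ (-1/2),
    while it makes an excursion of size e / 2 with probability O(1 / n). Hence
    for large n both requirements can be met together, with some positive
    probability p. The constants 96 and 192 are 6 * 4 ^ 2 and 2 * 6 * 4 ^ 2,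
    where 6 comes from the normal tail bound, 4 from the threshold e / 4, and 2
    from the maximal inequality. *)
Lemma small_block (s e : R) : 0 < s -> 0 < e -> exists2 n : nat, (0 < n)%N &
  exists2 p : R, 0 < p &
    96 * (s / n%:R) / e ^+ 2 <= 1 / 2 /\
    p + 192 * (s / n%:R) / e ^+ 2 <=
      2 * (e / (2 * n%:R)) * normal_pdf 0 (Num.sqrt (s / n%:R)) (e / (2 * n%:R)).
Proof.
move=> s0 e0.
have e20 : 0 < e ^+ 2 by rewrite exprn_gt0.
pose c := e ^+ 3 / (384 * s).
have c0 : 0 < c by rewrite /c divr_gt0// ?exprn_gt0// mulr_gt0.
have pi0 : 0 < pi :> R := pi_gt0 R.
(* Each term of M is a lower bound on n: for the inequality on 96, for the
   exponential in the density to be at least 1/2, and for its prefactor to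
   dominate the excursion term. *)
pose M := 192 * s / e ^+ 2 + e ^+ 2 / (4 * s) + 2 * pi * s / c ^+ 2.
have [n Mn] : exists n : nat, M < n%:R.
  by exists (Num.truncn M).+1; exact: truncnS_gt.
have t1 : 0 < 192 * s / e ^+ 2 by rewrite divr_gt0// mulr_gt0.
have t2 : 0 < e ^+ 2 / (4 * s) by rewrite divr_gt0// mulr_gt0.
have t3 : 0 < 2 * pi * s / c ^+ 2 by rewrite divr_gt0 ?exprn_gt0// !mulr_gt0.
have n0 : 0 < n%:R :> R by apply: lt_trans Mn; rewrite !addr_gt0.
exists n; first by rewrite -(ltr_nat R).
have sn0 : 0 < s / n%:R by rewrite divr_gt0.
set pdf := normal_pdf _ _ _.
have pdfE : pdf = (Num.sqrt (2 * pi * s / n%:R))^-1 * expR (- (e ^+ 2 / (8 * (n%:R * s)))).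
  rewrite /pdf normal_pdfE ?gt_eqF ?sqrtr_gt0// /normal_peak /normal_fun.
  rewrite sqr_sqrtr ?ltW//; congr ((Num.sqrt _)^-1 * expR _); first by field; rewrite gt_eqF.
  by field; rewrite !gt_eqF.
have r0 : 0 < Num.sqrt (2 * pi * s / n%:R) by rewrite sqrtr_gt0 divr_gt0// !mulr_gt0.
have rc : Num.sqrt (2 * pi * s / n%:R) < c.
  rewrite -(ger0_norm (ltW c0)) -sqrtr_sqr ltr_sqrt ?exprn_gt0//.
  have : 2 * pi * s / c ^+ 2 < n%:R.
    by apply: le_lt_trans Mn; rewrite /M lerDr addr_ge0// ltW.
  by rewrite !ltr_pdivrMr ?exprn_gt0// [n%:R * _]mulrC.
have ex : 1 / 2 <= expR (- (e ^+ 2 / (8 * (n%:R * s)))).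
  apply: le_trans (expR_ge1Dx _).
  suff : e ^+ 2 / (8 * (n%:R * s)) <= 1 / 2 by lra.
  rewrite ler_pdivrMr ?mulr_gt0//.
  rewrite (_ : 1 / 2 * _ = n%:R * (4 * s)); last by field.
  rewrite -ler_pdivrMr ?mulr_gt0//.
  by apply: le_trans (ltW Mn); rewrite /M; lra.
exists (2 * (e / (2 * n%:R)) * pdf - 192 * (s / n%:R) / e ^+ 2); last first.
  split; last lra.
  rewrite ler_pdivrMr//.
  rewrite [leLHS](_ : _ = 96 * s / n%:R); last by field; rewrite gt_eqF.
  rewrite ler_pdivrMr//.
  rewrite (_ : 1 / 2 * _ * _ = (1 / 2 * n%:R) * e ^+ 2); last by field.
  rewrite -ler_pdivrMr//.
  have -> : 96 * s / e ^+ 2 = 1 / 2 * (192 * s / e ^+ 2) by field; rewrite gt_eqF.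
  by rewrite ler_pM2l//; apply: le_trans (ltW Mn); rewrite /M; lra.
rewrite subr_gt0 pdfE.
have : c^-1 * (1 / 2) < (Num.sqrt (2 * pi * s / n%:R))^-1 * expR (- (e ^+ 2 / (8 * (n%:R * s)))).
  apply: (@lt_le_trans _ _ ((Num.sqrt (2 * pi * s / n%:R))^-1 * (1 / 2))).
    by rewrite ltr_pM2r// ltf_pV2// posrE.
  by rewrite ler_pM2l// invr_gt0.
have en0 : 0 < 2 * (e / (2 * n%:R)) by rewrite mulr_gt0// divr_gt0// mulr_gt0.
rewrite -(ltr_pM2l en0 (c^-1 * (1 / 2))) => h; apply: le_lt_trans h.
rewrite /c le_eqVlt; apply/orP; left; apply/eqP.
by field; rewrite !gt_eqF.
Qed.

End NormalEstimates.

(** * A maximal inequality *)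

Section FirstPassage.
Context {T : Type} {R : realType}.
Variables (S : nat -> T -> R) (L : nat) (a : R).

Definition first_passage l : set T :=
  [set omega | (forall j, (j < l)%N -> `|S j omega| <= a) /\ a < `|S l omega|].

Definition small_remainder l : set T :=
  [set omega | `|S L omega - S l omega| <= a / 2].

End FirstPassage.

Section Ottaviani.
Context {d : measure_display} {T : measurableType d} {R : realType}.

Lemma measurable_first_passage (S : nat -> T -> R) a l :
  (forall j, (j <= l)%N -> measurable_fun setT (S j)) ->
  measurable (first_passage S a l).
Proof.
move=> mS; rewrite (_ : first_passage S a l =
    (\bigcap_(j in `I_l) [set omega | `|S j omega| <= a])
    `&` [set omega | a < `|S l omega|]); last by apply/seteqP; split.
apply: measurableI; last by apply: measurable_normr_gt; exact: mS.
apply: fin_bigcap_measurable => [|j /= jl]; first exact: finite_II.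
by apply: measurable_normr_le; apply: mS; exact: ltnW.
Qed.

Variable P : probability T R.
Variables (S : nat -> T -> R) (L : nat) (a : R).
Hypothesis mS : forall l, measurable_fun setT (S l).
Notation first_passage := (first_passage S a).
Notation small_remainder := (small_remainder S L a).

Lemma measurable_small_remainder l : measurable (small_remainder l).
Proof.
by apply: (measurable_normr_le (fun omega => S L omega - S l omega)); exact: measurable_funB.
Qed.

Hypothesis indepS : forall l, (l <= L)%N ->
  P (first_passage l `&` small_remainder l) =
  (P (first_passage l) * P (small_remainder l))%E.
Hypothesis half : forall l, (l <= L)%N -> ((1 / 2)%:E <= P (small_remainder l))%E.

(** Ottaviani's inequality. When the walk first leaves [- a, a] at time l, it is
    still outside [- a / 2, a / 2] at the final time L unless it moves by more
    than a / 2 in between; by independence the latter is avoided with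
    probability at least 1/2. *)
Lemma ottaviani :
  (P [set omega | exists2 l, (l <= L)%N & (a < `|S l omega|)%R] <=
   2%:E * P [set omega | a / 2 < `|S L omega|]%R)%E.
Proof.
have disj : trivIset setT first_passage.
  apply/trivIsetP => i j _ _; rewrite neq_ltn => /orP[] ij;
  apply/seteqP; split => // omega [[h1 h2] [h3 h4]].
    by have := h3 _ ij; rewrite real_leNgt ?num_real// h2.
  by have := h1 _ ij; rewrite real_leNgt ?num_real// h4.
have -> : [set omega | exists2 l, (l <= L)%N & a < `|S l omega|] =
    \big[setU/set0]_(l < L.+1) first_passage l.
  rewrite -bigcup_mkord; apply/seteqP; split => omega /=.
    move=> [l lL al]; pose Q j := (j <= L)%N && (a < `|S j omega|).
    have exQ : exists j, Q j by exists l; rewrite /Q lL.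
    have [m /andP[mL am] mmin] := ex_minnP exQ.
    exists m => //; split => // j jm; rewrite real_leNgt ?num_real//.
    apply/negP => aj; have := mmin j; rewrite /Q aj andbT.
    by rewrite (leq_trans (ltnW jm) mL) leqNgt jm => /(_ isT).
  by move=> [l /= lL [_ al]]; exists l.
have mA l : measurable (first_passage l) by exact: measurable_first_passage.
have mC := measurable_small_remainder.
rewrite measure_semi_additive_ord_I//; last 2 first.
- by apply: sub_trivIset disj.
- exact: bigsetU_measurable.
apply: (@le_trans _ _ (\sum_(l < L.+1)
    2%:E * P (first_passage l `&` small_remainder l))%E).
  apply: lee_sum => l _; rewrite indepS -1?ltnS// muleCA -[leLHS]mule1.
  apply: lee_wpmul2l => //.
  have := half l; rewrite -ltnS => /(_ (ltn_ord l)) hl.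
  apply: le_trans (lee_wpmul2l _ hl) => //.
  by rewrite -EFinM lee_fin; lra.
rewrite -ge0_sume_distrr//; apply: lee_wpmul2l => //.
rewrite -(@measure_semi_additive_ord_I _ _ _ P (fun l => first_passage l `&` small_remainder l)); last 3 first.
- by move=> l _; exact: measurableI.
- by apply: trivIset_setIr; apply: sub_trivIset disj.
- by apply: bigsetU_measurable => l _; exact: measurableI.
have mU : measurable (\big[setU/set0]_(l < L.+1) (first_passage l `&` small_remainder l)).
  by apply: bigsetU_measurable => l _; exact: measurableI.
have mE : measurable [set omega | a / 2 < `|S L omega|] by exact: measurable_normr_gt.
apply: le_measure; [exact/mem_set|exact/mem_set|].
apply: (big_ind (fun X : set T => X `<=` _)) => [|X Y XE YE|l _].
- exact: sub0set.
- by move=> omega [/XE|/YE].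
move=> omega [[_ al] sl] /=.
have : `|S l omega| <= `|S L omega| + `|S L omega - S l omega|.
  by rewrite -[S l omega](subKr (S L omega)) (le_trans (ler_normB _ _))// opprB addrCA subrr addr0.
by move: al sl; rewrite /small_remainder/=; lra.
Qed.

End Ottaviani.

(** * Brownian increments on a uniform grid *)

Section BrownianIncrements.
Context {d : measure_display} {T : measurableType d} {R : realType}.
Variable P : probability T R.
Variables (n : nat) (B : 'I_n -> T -> R -> R).
Hypothesis B_bm : brownian_motion P n B.

Lemma measurable_brownian k u : 0 <= u -> measurable_fun setT (B k ^~ u).
Proof. by have [_ _ + _] := B_bm; exact. Qed.

Lemma brownian_increment k (u v : R) (A : set R) : 0 <= u -> u < v ->
  measurable A ->
  P [set omega | A (B k omega v - B k omega u)] =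
  normal_prob 0 (Num.sqrt (v - u)) A.
Proof.
move=> u0 uv mA; have [_ _ _ law] := B_bm.
have := law 1%N (fun i => if i is 0%N then u else v)
  (fun k' _ => if k' == k then A else setT).
move=> /(_ u0) => /(_ ltac:(by case)) => /(_ ltac:(by move=> k' _; case: ifP)).
rewrite (bigD1 k)//= big_ord1 eqxx/= big1 ?mule1; last first.
  by move=> k' /negPf ->; rewrite big_ord1 probability_setT.
move=> <-; congr (P _); apply/seteqP; split => omega /=.
  by move=> h k' i; case: eqP => // ->; rewrite ord1.
by move=> /(_ k ord0); rewrite eqxx.
Qed.

Variables (h : R) (N : nat).
Hypothesis h_gt0 : 0 < h.

Definition grid_increment (p : 'I_n * 'I_N) (omega : T) : R :=
  B p.1 omega (h * p.2.+1%:R) - B p.1 omega (h * p.2%:R).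

Let grid_ge0 (j : nat) : 0 <= h * j%:R.
Proof. by rewrite mulr_ge0// ltW. Qed.

Lemma measurable_grid_increment p : measurable_fun setT (grid_increment p).
Proof. by apply: measurable_funB; exact: measurable_brownian. Qed.

Lemma independent_grid_increment (A : 'I_n * 'I_N -> set R) :
  (forall p, measurable (A p)) ->
  P [set omega | forall p, A p (grid_increment p omega)] =
  (\prod_p P (grid_increment p @^-1` A p))%E.
Proof.
move=> mA; have [_ _ _ law] := B_bm.
have lt_grid i : h * i%:R < h * i.+1%:R by rewrite ltr_pM2l// ltr_nat.
have := law N (fun i => h * i%:R) (fun k i => A (k, i)).
move=> /(_ (grid_ge0 0) (fun i _ => lt_grid i) (fun k i => mA (k, i))).
rewrite pair_big/= => lawN.
rewrite (_ : [set omega | _] = [set omega | forall (k : 'I_n) (i : 'I_N),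
    A (k, i) (B k omega (h * i.+1%:R) - B k omega (h * i%:R))]); last first.
  by apply/seteqP; split => omega /= hA; [move=> k i; exact: (hA (k, i))|case=> k i; exact: hA].
rewrite lawN; apply: eq_bigr => -[k i] _.
by rewrite -(brownian_increment k).
Qed.

(** Increments over several grid steps belong to the sigma-algebra of the
    elementary increments they are made of. *)
Lemma measurable_block_increment (J : pred ('I_n * 'I_N)) k (u v : nat) :
  (u <= v <= N)%N -> (forall i : 'I_N, (u <= i < v)%N -> J (k, i)) ->
  measurable_fun setT (fun omega : g_sigma_algebraType (cylinders grid_increment J) =>
    B k omega (h * v%:R) - B k omega (h * u%:R)).
Proof.
elim: v => [|v IH].
  rewrite leqn0 => /andP[/eqP -> _] _.
  by under eq_fun do rewrite subrr; exact: measurable_cst.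
case/andP; rewrite leq_eqVlt => /predU1P[-> _ _|].
  by under eq_fun do rewrite subrr; exact: measurable_cst.
rewrite ltnS => uv vN JJ.
under eq_fun => omega do rewrite -(subrKA (B k omega (h * v%:R))).
apply: measurable_funD; last first.
  apply: IH; first by rewrite uv ltnW.
  by move=> i /andP[ui iv]; apply: JJ; rewrite ui ltnS ltnW.
move=> _ Y mY; rewrite setTI; apply: sub_sigma_algebra.
exists (fun p => if p == (k, Ordinal vN) then Y else setT).
  by move=> p; case: ifP.
apply/seteqP; split => omega /=.
  by move=> Yo p _; case: eqP => // ->.
by move=> /(_ (k, Ordinal vN)); rewrite eqxx; apply; apply: JJ; rewrite /= uv leqnn.
Qed.

End BrownianIncrements.

(** * Small balls around the origin have positive Wiener measure *)

Section DenseGrid.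
Context {R : realType}.

Lemma dense_grid (w : R -> R) (s c : R) (nb : nat) : 0 < s -> (0 < nb)%N ->
  {within `[0, s]%classic, continuous w} ->
  (forall m j, (j <= nb * 2 ^ m)%N -> w (s / (nb * 2 ^ m)%:R * j%:R) <= c) ->
  forall u, 0 <= u <= s -> w u <= c.
Proof.
move=> s0 nb0 cw wle u u0s; rewrite real_leNgt ?num_real//; apply/negP => cu.
have us : `[0, s]%classic u by rewrite /= in_itv.
have /subspace_continuousP /(_ u us) wu := cw.
have /nbhs_ballP[/= de de0 near_u] : \forall v \near within `[0, s]%classic (nbhs u), c < w v.
  exact: (cvgr_gt _ wu).
have nbR : 0 < nb%:R :> R by rewrite ltr0n.
have [m hm] : exists m, s / (nb * 2 ^ m)%:R < de.
  exists (Num.truncn (s / (nb%:R * de))).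
  set m := Num.truncn _.
  have m2 : s / (nb%:R * de) < (2 ^ m)%:R.
    apply: (@lt_le_trans _ _ m.+1%:R); first exact: truncnS_gt.
    by rewrite ler_nat ltn_expl.
  rewrite natrM ltr_pdivrMr ?mulr_gt0// ?ltr0n ?expn_gt0//.
  by move: m2; rewrite ltr_pdivrMr ?mulr_gt0//; congr (_ < _); ring.
set N := (nb * 2 ^ m)%N in hm.
have N0 : 0 < N%:R :> R by rewrite ltr0n muln_gt0 nb0 expn_gt0.
set h := s / N%:R in hm.
have h0 : 0 < h by rewrite divr_gt0.
have /andP[u0 us'] := u0s.
have uh0 : 0 <= u / h by rewrite divr_ge0// ltW.
pose j := Num.truncn (u / h).
have /andP[ju uj] := truncn_itv uh0.
have jhu : h * j%:R <= u by rewrite mulrC -ler_pdivlMr.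
have uhj : u < h * j%:R + h.
  by move: uj; rewrite ltr_pdivrMr// -natr1 mulrDl mul1r mulrC.
have jN : (j <= N)%N.
  rewrite -(ler_nat R) -(ler_pM2l h0) (le_trans jhu)// (le_trans us')//.
  by rewrite /h divfK ?gt_eqF.
have := wle m j jN; rewrite -/N -/h real_leNgt ?num_real// => /negP; apply.
apply: near_u.
  by rewrite /ball/= ltr_distl; apply/andP; split; lra.
rewrite /= in_itv/= (le_trans jhu us') andbT.
by rewrite mulr_ge0// ltW.
Qed.

End DenseGrid.

Section SmallBall.
Context {d : measure_display} {T : measurableType d} {R : realType}.
Variable P : probability T R.
Variables (n : nat) (B : 'I_n -> T -> R -> R).
Hypothesis B_bm : brownian_motion P n B.
Variables (s e : R) (nb : nat) (p : R).
Hypotheses (s_gt0 : 0 < s) (e_gt0 : 0 < e) (nb_gt0 : (0 < nb)%N) (p_gt0 : 0 < p).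
Hypothesis half : 96 * (s / nb%:R) / e ^+ 2 <= 1 / 2.
Hypothesis p_le : p + 192 * (s / nb%:R) / e ^+ 2 <=
  2 * (e / (2 * nb%:R)) * normal_pdf 0 (Num.sqrt (s / nb%:R)) (e / (2 * nb%:R)).

(** The interval [0, s] consists of nb blocks of L grid steps each. The bound
    obtained below for the grid event does not depend on L. *)
Section FixedMesh.
Variables (L : nat).
Hypothesis L_gt0 : (0 < L)%N.

Let N := (nb * L)%N.
Let h := s / N%:R.

Let N_gt0 : 0 < N%:R :> R. Proof. by rewrite ltr0n muln_gt0 nb_gt0. Qed.
Let nbR_gt0 : 0 < nb%:R :> R. Proof. by rewrite ltr0n. Qed.
Let LR_gt0 : 0 < L%:R :> R. Proof. by rewrite ltr0n. Qed.
Let h_gt0 : 0 < h. Proof. by rewrite divr_gt0. Qed.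
Let hL : h * L%:R = s / nb%:R.
Proof. by rewrite /h /N natrM; field; rewrite !gt_eqF. Qed.
Let grid_ge0 (j : nat) : 0 <= h * j%:R.
Proof. by rewrite mulr_ge0// ltW. Qed.

Let X := grid_increment n B h N.
Let mX := measurable_grid_increment P n B B_bm h N h_gt0.

Definition block_walk (r : 'I_n * 'I_nb) (l : nat) (omega : T) : R :=
  B r.1 omega (h * (r.2 * L + l)%:R) - B r.1 omega (h * (r.2 * L)%:R).

(** Coordinate r.1 stays within e / 2 of its value at the start of block r.2 and
    ends the block within e / (2 nb) of it. The second condition keeps the
    drift accumulated over all nb blocks below e / 2. *)
Definition block_event (r : 'I_n * 'I_nb) : set T :=
  (\bigcap_(l in `I_L.+1) [set omega | `|block_walk r l omega| <= e / 2]) `&`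
  [set omega | `|block_walk r L omega| <= e / (2 * nb%:R)].

Let past_index (r : 'I_n * 'I_nb) (l : nat) : pred ('I_n * 'I_N) :=
  fun q => (q.1 == r.1) && (r.2 * L <= q.2 < r.2 * L + l)%N.
Let block_index r := past_index r L.

Let block_le (r : 'I_n * 'I_nb) : (r.2 * L + L <= N)%N.
Proof. by rewrite addnC -mulSn /N leq_mul2r ltn_ord orbT. Qed.

Let measurable_walk r l : measurable_fun setT (block_walk r l).
Proof. by apply: measurable_funB; exact: (measurable_brownian P n B B_bm). Qed.

Lemma block_event_sigma r : <<s cylinders X (block_index r) >> (block_event r).
Proof.
pose G := g_sigma_algebraType (cylinders X (block_index r)).
suff : measurable (block_event r : set G) by [].
have mwalk l : (l <= L)%N -> measurable_fun setT (block_walk r l : G -> R).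
  move=> lL.
  apply: (measurable_block_increment n B h N (block_index r) r.1 (r.2 * L) (r.2 * L + l)).
    by rewrite leq_addr (leq_trans _ (block_le r))// leq_add2l.
  move=> i /andP[i1 i2]; rewrite /block_index /past_index eqxx/= i1/=.
  by rewrite (leq_trans i2)// leq_add2l.
apply: measurableI; last by apply: measurable_normr_le; exact: mwalk.
apply: fin_bigcap_measurable => [|l /= lL]; first exact: finite_II.
by apply: measurable_normr_le; exact: mwalk.
Qed.

Lemma measurable_block_event r : measurable (block_event r).
Proof.
apply: measurableI; last exact: measurable_normr_le.
by apply: fin_bigcap_measurable => [|l _]; [exact: finite_II|exact: measurable_normr_le].
Qed.

Lemma block_walk_tail r l c : (l < L)%N -> 0 < c ->
  (P [set omega | c < `|block_walk r L omega - block_walk r l omega|]%R <=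
   (6 * (s / nb%:R) / c ^+ 2)%:E)%E.
Proof.
move=> lL c0.
rewrite (_ : mkset _ = [set omega | [set x | c < `|x|]
   (B r.1 omega (h * (r.2 * L + L)%:R) - B r.1 omega (h * (r.2 * L + l)%:R))]); last first.
  by apply/seteqP; split => omega; rewrite /= /block_walk opprB addrA subrK.
rewrite (brownian_increment P n B B_bm)//; last 2 first.
- by rewrite ltr_pM2l// ltr_nat ltn_add2l.
- exact: (measurable_normr_gt id).
have -> : h * (r.2 * L + L)%:R - h * (r.2 * L + l)%:R = h * (L - l)%:R.
  by rewrite !natrD natrB ?(ltnW lL)//; ring.
have v0 : 0 < h * (L - l)%:R by rewrite mulr_gt0// ltr0n subn_gt0.
apply: (le_trans (normal_tail _ _ _ c0)); first by rewrite sqrtr_gt0.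
rewrite lee_fin sqr_sqrtr ?(ltW v0)// ler_pM2r ?invr_gt0 ?exprn_gt0// ler_pM2l//.
by rewrite -hL ler_pM2l// ler_nat leq_subr.
Qed.

Lemma small_remainder_half r l : (l <= L)%N ->
  ((1 / 2)%:E <= P (small_remainder (block_walk r) L (e / 2) l))%E.
Proof.
rewrite leq_eqVlt => /predU1P[->|lL].
  rewrite (_ : small_remainder _ L (e / 2) L = setT).
    by rewrite probability_setT lee_fin; lra.
  apply/seteqP; split => // omega _; rewrite /small_remainder/= subrr normr0.
  by rewrite !divr_ge0// ltW.
pose W omega := block_walk r L omega - block_walk r l omega.
have mW : measurable_fun setT W by exact: measurable_funB.
have -> : small_remainder (block_walk r) L (e / 2) l =
    ~` [set omega | e / 2 / 2 < `|W omega|] by rewrite normr_gtE setCK.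
have mD := measurable_normr_gt W (e / 2 / 2) mW.
rewrite probability_setC//.
have := block_walk_tail r l (e / 2 / 2) lL; rewrite -/(W _).
move=> /(_ ltac:(by rewrite !divr_gt0)).
rewrite -[P _]fineK ?fin_num_measure// lee_fin -EFinB lee_fin.
have -> : 6 * (s / nb%:R) / (e / 2 / 2) ^+ 2 = 96 * (s / nb%:R) / e ^+ 2.
  by field; rewrite !gt_eqF.
by move: half; lra.
Qed.

Lemma independent_first_passage r l : (l <= L)%N ->
  P (first_passage (block_walk r) (e / 2) l `&`
     small_remainder (block_walk r) L (e / 2) l) =
  (P (first_passage (block_walk r) (e / 2) l) *
   P (small_remainder (block_walk r) L (e / 2) l))%E.
Proof.
move=> lL; apply: (independent_cylinders P X mX _ (past_index r l)).
- exact: (independent_grid_increment P n B B_bm h N h_gt0).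
- pose G := g_sigma_algebraType (cylinders X (past_index r l)).
  suff : measurable (first_passage (block_walk r) (e / 2) l : set G) by [].
  apply: measurable_first_passage => j jl.
  apply: (measurable_block_increment n B h N _ r.1 (r.2 * L) (r.2 * L + j)).
    rewrite leq_addr (leq_trans _ (block_le r))// leq_add2l.
    exact: leq_trans jl lL.
  move=> i /andP[i1 i2]; rewrite /past_index eqxx/= i1/=.
  by rewrite (leq_trans i2)// leq_add2l.
- pose G := g_sigma_algebraType (cylinders X (predC (past_index r l))).
  suff : measurable (small_remainder (block_walk r) L (e / 2) l : set G) by [].
  apply: (@measurable_normr_le _ G R
    (fun omega => block_walk r L omega - block_walk r l omega)).
  rewrite (_ : (fun x => _) = fun omega : G =>
     B r.1 omega (h * (r.2 * L + L)%:R) - B r.1 omega (h * (r.2 * L + l)%:R)); last first.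
    by apply/funext => omega; rewrite /block_walk opprB addrA subrK.
  apply: measurable_block_increment.
    by rewrite leq_add2l lL block_le.
  by move=> i /andP[i1 i2] /=; rewrite /past_index eqxx/= negb_and -[X in _ || X]leqNgt i1 orbT.
Qed.

Definition long_excursion r : set T :=
  [set omega | exists2 l, (l <= L)%N & e / 2 < `|block_walk r l omega|].

Lemma measurable_long_excursion r : measurable (long_excursion r).
Proof.
rewrite (_ : long_excursion r =
    \bigcup_(l in `I_L.+1) [set omega | e / 2 < `|block_walk r l omega|]).
  by apply: fin_bigcup_measurable => [|l _]; [exact: finite_II|exact: measurable_normr_gt].
by apply/seteqP; split => omega [l lL h1]; exists l.
Qed.

Lemma long_excursion_probability r :
  (P (long_excursion r) <= (192 * (s / nb%:R) / e ^+ 2)%:E)%E.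
Proof.
apply: le_trans (ottaviani P (block_walk r) L (e / 2) (measurable_walk r)
  (independent_first_passage r) (small_remainder_half r)) _.
have walk0 omega : block_walk r 0 omega = 0 by rewrite /block_walk addn0 subrr.
have := block_walk_tail r 0 (e / 2 / 2) L_gt0.
move=> /(_ ltac:(by rewrite !divr_gt0)).
under eq_set do rewrite walk0 subr0.
move=> tail; apply: le_trans (lee_wpmul2l _ tail) _ => //.
rewrite -EFinM lee_fin le_eqVlt; apply/orP; left; apply/eqP.
by field; rewrite !gt_eqF.
Qed.

Lemma block_return_probability r :
  ((p + 192 * (s / nb%:R) / e ^+ 2)%:E <=
   P [set omega | (`|block_walk r L omega| <= e / (2 * nb%:R))%R])%E.
Proof.
rewrite (_ : mkset _ = [set omega | [set x | `|x| <= e / (2 * nb%:R)]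
  (B r.1 omega (h * (r.2 * L + L)%:R) - B r.1 omega (h * (r.2 * L)%:R))])//.
rewrite (brownian_increment P n B B_bm)//; last 2 first.
- by rewrite ltr_pM2l// ltr_nat -[ltnLHS]addn0 ltn_add2l.
- exact: (measurable_normr_le id).
have -> : h * (r.2 * L + L)%:R - h * (r.2 * L)%:R = s / nb%:R.
  by rewrite -hL natrD; ring.
apply: le_trans (normal_center _ _ _ _); last 2 first.
- by rewrite sqrtr_gt0 divr_gt0.
- by rewrite divr_gt0// mulr_gt0.
by rewrite lee_fin.
Qed.

Lemma block_event_probability r : (p%:E <= P (block_event r))%E.
Proof.
have mlong := measurable_long_excursion r.
pose back : set T := [set omega | `|block_walk r L omega| <= e / (2 * nb%:R)].
have mback : measurable back by exact: measurable_normr_le.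
have sub : back `\` long_excursion r `<=` block_event r.
  move=> omega [near nlong]; split => // l /= lL.
  by rewrite real_leNgt ?num_real//; apply/negP => ll; apply: nlong; exists l.
have mD : measurable (back `\` long_excursion r) by exact: measurableD.
apply: (@le_trans _ _ (P (back `\` long_excursion r))); last first.
  by apply: le_measure => //; apply/mem_set => //; exact: measurable_block_event.
have PD : (P back <= P (back `\` long_excursion r) + P (long_excursion r))%E.
  rewrite (measureDI P mback mlong) leeD2l//.
  by apply: le_measure; [apply/mem_set; exact: measurableI|exact/mem_set|exact: subIsetr].
have := long_excursion_probability r; have := block_return_probability r; move: PD.
rewrite -/back -(fineK (fin_num_measure P _ mD)) -(fineK (fin_num_measure P _ mlong)).
rewrite -(fineK (fin_num_measure P _ mback)) -EFinD !lee_fin.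
lra.
Qed.

Lemma block_events_probability (rs : seq ('I_n * 'I_nb)) : uniq rs ->
  ((p ^+ size rs)%:E <= P (\big[setI/setT]_(r <- rs) block_event r))%E.
Proof.
elim: rs => [_|r rs IH /= /andP[rrs urs]].
  by rewrite big_nil probability_setT expr0.
rewrite big_cons.
rewrite (independent_cylinders P X mX
   (independent_grid_increment P n B B_bm h N h_gt0) (block_index r)); last 2 first.
- exact: block_event_sigma.
- pose G := g_sigma_algebraType (cylinders X (predC (block_index r))).
  suff : measurable (\big[setI/setT]_(r' <- rs) block_event r' : set G) by [].
  rewrite big_seq; apply: big_ind => [|E F|r' r'rs].
  + exact: (@measurableT _ G).
  + exact: (@measurableI _ G).
  + have := block_event_sigma r'; apply: sub_sigma_algebra2.
    apply: sub_cylinders => -[k j] /andP[/= /eqP -> /andP[j1 j2]].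
    apply/negP => /andP[/= /eqP r1 /andP[j3 j4]].
    suff r2 : r'.2 = r.2 :> nat.
      by move/negP: rrs; apply; rewrite (_ : r = r')//; case: (r) (r') r1 r2 => a b [a' b'] /= -> /ord_inj ->.
    have lt1 : (r.2 * L < r'.2.+1 * L)%N by rewrite mulSn addnC (leq_ltn_trans j3).
    have lt2 : (r'.2 * L < r.2.+1 * L)%N by rewrite mulSn addnC (leq_ltn_trans j1).
    move: lt1 lt2; rewrite !ltn_pmul2r// !ltnS => a1 a2.
    by apply/eqP; rewrite eqn_leq a1 a2.
rewrite exprS EFinM; apply: lee_pmul => //.
- by rewrite lee_fin ltW.
- by rewrite lee_fin exprn_ge0// ltW.
- exact: block_event_probability.
- exact: IH.
Qed.

Definition grid_event : set T :=
  [set omega | forall k (j : nat), (j <= N)%N -> `|B k omega (h * j%:R)| <= e].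

Lemma measurable_grid_event : measurable grid_event.
Proof.
rewrite (_ : grid_event = \bigcap_(k in [set: 'I_n]) \bigcap_(j in `I_N.+1)
   [set omega | `|B k omega (h * j%:R)| <= e]); last first.
  by apply/seteqP; split => omega /= hB k => [_ j|j jN]; apply: hB.
apply: fin_bigcap_measurable => // k _.
apply: fin_bigcap_measurable => [|j _]; first exact: finite_II.
apply: measurable_normr_le.
exact: (measurable_brownian P n B B_bm).
Qed.

(** At the end of block i the path is within (i + 1) e / (2 nb) of the origin, so
    always within e / 2, and inside a block it deviates by at most e / 2 more. *)
Lemma block_events_sub :
  \big[setI/setT]_(r : 'I_n * 'I_nb) block_event r `<=` grid_event.
Proof.
move=> omega blocks.
have {}blocks r : block_event r omega.
  by move: blocks; rewrite (bigD1 r)//= => -[].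
move=> k j jN.
have nbe i : (i <= nb)%N -> `|B k omega (h * (i * L)%:R)| <= i%:R * (e / (2 * nb%:R)).
  elim: i => [_|i IH ilt].
    by have [B0 _ _ _] := B_bm; rewrite mul0n mulr0 B0 normr0 mul0r.
  have [_ /= step] := blocks (k, Ordinal ilt).
  rewrite /block_walk/= in step.
  rewrite mulSn addnC -(subrK (B k omega (h * (i * L)%:R)) (B k omega _)).
  rewrite (le_trans (ler_normD _ _))// -natr1 mulrDl mul1r addrC lerD// IH//.
  exact: ltnW.
have ene : nb%:R * (e / (2 * nb%:R)) = e / 2 by field; rewrite gt_eqF.
have [jlt|jge] := ltnP j N; last first.
  have -> : j = (nb * L)%N by apply/eqP; rewrite eqn_leq jN.
  apply: le_trans (nbe _ (leqnn nb)) _; rewrite ene; move: e_gt0; lra.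
have ilt : (j %/ L < nb)%N by rewrite ltn_divLR.
have [/(_ (j %% L)%N) /= step _] := blocks (k, Ordinal ilt).
have := step (ltnW (ltn_pmod j L_gt0)); rewrite /block_walk/= -divn_eq => {}step.
rewrite -(subrK (B k omega (h * (j %/ L * L)%:R)) (B k omega _)).
rewrite (le_trans (ler_normD _ _))// (le_trans (lerD step (nbe _ (ltnW ilt))))//.
suff : (j %/ L)%:R * (e / (2 * nb%:R)) <= e / 2 by move: e_gt0; lra.
rewrite -ene ler_wpM2r//; last by rewrite ler_nat ltnW.
by rewrite divr_ge0// ?ltW// mulr_gt0.
Qed.

Lemma grid_event_probability : ((p ^+ #|{: 'I_n * 'I_nb}|)%:E <= P grid_event)%E.
Proof.
have := block_events_probability (enum {: 'I_n * 'I_nb}) (enum_uniq _).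
rewrite -cardE => /le_trans; apply.
have mbig : measurable (\big[setI/setT]_(r <- enum {: 'I_n * 'I_nb}) block_event r).
  by apply: big_ind => [||r _]; [exact: measurableT|exact: measurableI|exact: measurable_block_event].
apply: le_measure; [exact/mem_set|apply/mem_set; exact: measurable_grid_event|].
by rewrite big_enum; exact: block_events_sub.
Qed.

End FixedMesh.

(** Refining the mesh by powers of 2, the grid events decrease to an event that
    by continuity bounds the whole path. *)
Lemma small_ball_event : exists E : set T, [/\ measurable E, (0 < P E)%E &
  forall omega, E omega -> forall k u, 0 <= u <= s -> `|B k omega u| <= e].
Proof.
pose F m := grid_event (2 ^ m).
have pow0 m : (0 < 2 ^ m)%N by rewrite expn_gt0.
have mF m : measurable (F m) by exact: measurable_grid_event.
have mI : measurable (\bigcap_m F m) by exact: bigcap_measurable.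
exists (\bigcap_m F m); split => //.
  have cvgF : P \o F @ \oo --> P (\bigcap_m F m).
    apply: nonincreasing_cvg_mu => //.
      by rewrite (le_lt_trans (probability_le1 P (mF 0%N)))// ltry.
    apply/nonincreasing_seqP => m; apply/subsetPset => omega Fm k j jN.
    have := Fm k (2 * j)%N; rewrite expnS mulnCA leq_mul2l jN orbT => /(_ isT).
    congr (`|B k omega _| <= e).
    rewrite !natrM; field.
    by rewrite !gt_eqF// ltr0n.
  have : ((p ^+ #|{: 'I_n * 'I_nb}|)%:E <= P (\bigcap_m F m))%E.
    rewrite -(cvg_lim _ cvgF)//; apply: lime_ge; first by apply/cvg_ex; eexists; exact: cvgF.
    by apply: nearW => m; exact: grid_event_probability.
  by apply: lt_le_trans; rewrite lte_fin exprn_gt0.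
move=> omega Eo k; apply: (dense_grid _ _ _ nb) => //.
  have [_ cB _ _] := B_bm.
  move=> u; apply: continuous_comp; last exact: norm_continuous.
  apply: (continuous_subspaceW _ (cB k omega)) => x /=.
  by rewrite !in_itv/= andbT => /andP[].
by move=> m j jN; exact: (Eo m).
Qed.

End SmallBall.

Lemma cvg_finite_sum {R : realType} {I T : Type} (F : set_system T) {FF : Filter F}
    (ks : seq I) (f : I -> T -> R) (l : I -> R) :
  (forall k, f k x @[x --> F] --> l k) ->
  \sum_(k <- ks) f k x @[x --> F] --> \sum_(k <- ks) l k.
Proof.
move=> fl; elim: ks => [|k ks IH].
  rewrite big_nil; under eq_fun do rewrite big_nil; exact: cvg_cst.
rewrite big_cons; under eq_fun do rewrite big_cons; exact: cvgD.
Qed.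

(** * Positivity of the density of the house-moving *)

Section HouseMoving.
Context {d : measure_display} {T : measurableType d} {R : realType}.
Variable P : probability T R.

Lemma small_ball (n : nat) (B : 'I_n -> T -> R -> R) (s e : R) :
  brownian_motion P n B -> 0 < s -> 0 < e ->
  exists E : set T, [/\ measurable E, (0 < P E)%E &
    forall omega, E omega -> forall k u, 0 <= u <= s -> `|B k omega u| <= e].
Proof.
move=> B_bm s0 e0; have [nb nb0 [p p0 [half ple]]] := small_block s e s0 e0.
exact: (small_ball_event P n B B_bm s e nb p).
Qed.

(** The law of the endpoint is given by the entrance density at v = s, whose
    last factor is then 1; differentiating the distribution function gives it
    back by continuity. *)
Lemma meander_end_density (s z : R) (M : T -> R -> R) : 0 < s -> 0 < z ->
  brownian_meander P s M ->
  density_at P (fun omega => M omega s) z =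
  Num.sqrt (2 * pi * s) * (z / s) * normal_pdf 0 (Num.sqrt s) z.
Proof.
move=> s0 z0 [_ _ law].
pose f y := Num.sqrt (2 * pi * s) * (y / s) * normal_pdf 0 (Num.sqrt s) y.
have cf : continuous f.
  move=> y; apply: cvgM; last by apply: continuous_normal_pdf; rewrite gt_eqF ?sqrtr_gt0.
  by apply: cvgM; [exact: cvg_cst|apply: cvgM; [exact: cvg_id|exact: cvg_cst]].
rewrite /density_at.
have -> : (fun x : R => Pr P [set omega | M omega s <= x]) =
    fun x => \int[lebesgue_measure]_(y in [set` Interval (BRight 0) (BRight x)]) f y.
  apply/funext => x; rewrite /Pr /Rintegral; congr fine.
  have := law 1%N (fun=> s) (fun=> `]-oo, x]%classic).
  move=> /(_ ltac:(by move=> i _; rewrite s0 lexx) ltac:(by []) ltac:(by [])).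
  rewrite /= (_ : mkset _ = [set omega | M omega s <= x]); last first.
    apply/seteqP; split => omega /=; first by move=> /(_ 0%N isT); rewrite in_itv.
    by move=> Mx i _; rewrite in_itv.
  move=> ->.
  rewrite (_ : _ `&` _ = [set` Interval (BRight 0) (BRight x)]); last first.
    by apply/seteqP; split => y /=; rewrite !in_itv/= andbT andbC => /andP.
  apply: eq_integral => y _.
  by rewrite /meander_density eqxx /abs_normal subrr eqxx mulr1 mule1.
have [] // := @continuous_FTC1 R f (BRight 0) z (z + 1) _ _ _ (cf z).
- by rewrite ltrDl.
- have int_f : lebesgue_measure.-integrable `[0, z + 1] (EFin \o f).
    apply: continuous_compact_integrable; first exact: segment_compact.
    exact: continuous_subspaceT.
  apply: (integrableS _ _ _ int_f) => //.
  by move=> y /=; rewrite !in_itv/= => /andP[/ltW -> ->].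
Qed.

Variables (B : 'I_3 -> T -> R -> R).
Hypothesis B_bm : brownian_motion P 3 B.

(* The squared norm avoids square roots where only bounds matter. *)
Let sq_bridge (s z : R) omega (u : R) : R :=
  \sum_(k < 3) bridge (B k) 0 s 0 (if k == ord0 then z else 0) omega u ^+ 2.

Lemma continuous_sq_bridge (s z : R) omega :
  {within `[0, s]%classic, continuous (sq_bridge s z omega)}.
Proof.
have [_ cB _ _] := B_bm.
apply/subspace_continuousP => u us; apply: cvg_finite_sum => k.
rewrite /GRing.exp/=.
suff bk : bridge (B k) 0 s 0 (if k == ord0 then z else 0) omega v
    @[v --> within `[0, s]%classic (nbhs u)] -->
    bridge (B k) 0 s 0 (if k == ord0 then z else 0) omega u.
  exact: cvgM.
rewrite /bridge; apply: cvgD; first (apply: cvgD; first exact: cvg_cst).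
  apply: cvgB; last exact: cvg_cst.
  have cBs : {within `[0, s]%classic, continuous (B k omega)}.
    apply: (continuous_subspaceW _ (cB k omega)) => x /=.
    by rewrite !in_itv/= andbT => /andP[].
  by move/subspace_continuousP : cBs; exact.
apply: cvgM; last exact: cvg_cst.
apply: cvgM; last exact: cvg_cst.
apply: cvgB; last exact: cvg_cst.
exact: cvg_within.
Qed.

Lemma Kle_bes3E (s z b : R) : 0 < s -> 0 < b ->
  [set omega | Kle 0 s b (bes3_bridge B s z omega)] =
  [set omega | forall u, 0 <= u <= s -> sq_bridge s z omega u <= b ^+ 2].
Proof.
move=> s0 b0.
have bE omega u : (bes3_bridge B s z omega u <= b) = (sq_bridge s z omega u <= b ^+ 2).
  by rewrite -[b in LHS](ger0_norm (ltW b0)) -sqrtr_sqr ler_sqrt ?sqr_ge0.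
apply/seteqP; split => omega /=.
  by move=> [_ le_b] u us; rewrite -bE; exact: le_b.
move=> le_b; split; last by move=> u us; rewrite bE; exact: le_b.
have /subspace_continuousP csq := continuous_sq_bridge s z omega.
apply/subspace_continuousP => u us.
by apply: (@continuous_cvg _ _ _ _ _ (sq_bridge s z omega) Num.sqrt); [exact: sqrt_continuous|exact: csq].
Qed.

Lemma measurable_Kle_bes3 (s z b : R) : 0 < s -> 0 < b ->
  measurable [set omega | Kle 0 s b (bes3_bridge B s z omega)].
Proof.
move=> s0 b0; rewrite Kle_bes3E//.
rewrite (_ : mkset _ = \bigcap_m \bigcap_(j in `I_(1 * 2 ^ m).+1)
  [set omega | sq_bridge s z omega (s / (1 * 2 ^ m)%:R * j%:R) <= b ^+ 2]); last first.
  apply/seteqP; split => omega /= hle.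
    move=> m _ j /= jm; apply: hle.
    rewrite mulr_ge0 ?divr_ge0 ?(ltW s0)//=.
    rewrite mulrAC ler_pdivrMr ?ltr0n ?muln_gt0 ?expn_gt0// ler_pM2l//.
    by rewrite ler_nat -ltnS.
  apply: (dense_grid _ _ _ 1) => //; first exact: continuous_sq_bridge.
  by move=> m j jm; exact: (hle m I j).
apply: bigcapT_measurable => m.
apply: fin_bigcap_measurable => [|j _]; first exact: finite_II.
apply: measurable_le_cst.
have [_ _ mB _] := B_bm.
apply: measurable_sum => k; apply: measurable_funX.
have u0 : 0 <= s / (1 * 2 ^ m)%:R * j%:R by rewrite mulr_ge0// divr_ge0// ltW.
apply: measurable_funD; first (apply: measurable_funD => //; apply: measurable_funB; exact: mB).
apply: measurable_funM => //; apply: measurable_funB => //.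
by apply: measurable_funB; apply: mB => //; exact: ltW.
Qed.

(** When all coordinates of the Brownian motion stay below e = (b - z) / 6 on
    [0, s], the bridge from 0 to (z, 0, 0) stays within 2 e of the straight
    segment in each coordinate, and (z + 2 e) ^ 2 + 2 (2 e) ^ 2 <= b ^ 2. *)
Lemma Kle_bes3_gt0 (s z b : R) : 0 < s -> 0 < z < b ->
  0 < Pr P [set omega | Kle 0 s b (bes3_bridge B s z omega)].
Proof.
move=> s0 /andP[z0 zb]; have b0 : 0 < b by exact: lt_trans zb.
have mK := measurable_Kle_bes3 s z b s0 b0.
pose e := (b - z) / 6.
have e0 : 0 < e by rewrite divr_gt0// subr_gt0.
have [E [mE PE Esmall]] := small_ball 3 B s e B_bm s0 e0.
rewrite /Pr fine_gt0// (le_lt_trans (probability_le1 P mK)) ?ltry// andbT.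
apply: (lt_le_trans PE); apply: le_measure; [exact/mem_set|exact/mem_set|].
rewrite Kle_bes3E// => omega Eo u /andP[u0 us] /=.
have [B0 _ _ _] := B_bm.
have small k := Esmall omega Eo k.
have q01 : 0 <= u / s <= 1 by rewrite divr_ge0 ?(ltW s0)//= ler_pdivrMr// mul1r.
have bridgeE k c : bridge (B k) 0 s 0 c omega u =
    B k omega u + u / s * (c - B k omega s).
  by rewrite /bridge B0 !subr0 add0r.
rewrite /sq_bridge 3!big_ord_recl big_ord0 !bridgeE/=.
have hu k : `|B k omega u| <= e by apply: small; rewrite u0.
have hs k : `|B k omega s| <= e by apply: small; rewrite (ltW s0)/=.
have coord (x y q c : R) : 0 <= q <= 1 -> 0 <= c -> `|x| <= e -> `|y| <= e ->
    (x + q * (c - y)) ^+ 2 <= (c + 2 * e) ^+ 2.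
  move=> /andP[q0 q1] c0 xe ye.
  have : `|x + q * (c - y)| <= c + 2 * e.
    rewrite (le_trans (ler_normD _ _))// normrM (ger0_norm q0).
    have le1 : q * `|c - y| <= `|c - y| by rewrite ler_piMl.
    have le2 : `|c - y| <= c + e by rewrite (le_trans (ler_normB _ _))// ger0_norm// lerD2l.
    by move: xe le1 le2; lra.
  move=> le_n; rewrite -(real_normK (num_real (x + _))) ler_sqr ?nnegrE//.
  by rewrite addr_ge0// mulr_ge0// ltW.
have := coord _ _ _ z q01 (ltW z0) (hu ord0) (hs ord0).
set i1 := lift ord0 _; set i2 := lift ord0 _.
have := coord _ _ _ 0 q01 (lexx 0) (hu i1) (hs i1).
have := coord _ _ _ 0 q01 (lexx 0) (hu i2) (hs i2).
have bE : b = z + 6 * e by rewrite /e; field.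
have ze : 0 < z * e by rewrite mulr_gt0.
have e2 : 0 < e * e by rewrite mulr_gt0.
rewrite bE !expr2; nra.
Qed.

Lemma house_q_gt0 (Wp : R -> T -> R -> R) (b s z : R) :
  brownian_meander P s (Wp s) -> 0 < s -> 0 < z < b ->
  0 < house_q P B Wp b s z.
Proof.
move=> mea s0 zb; have /andP[z0 _] := zb.
rewrite /house_q mulr_gt0 ?Kle_bes3_gt0// meander_end_density//.
have ss0 : Num.sqrt s != 0 by rewrite gt_eqF// sqrtr_gt0.
apply: mulr_gt0; last first.
  by rewrite normal_pdfE// mulr_gt0 ?expR_gt0// normal_peak_gt0.
by apply: mulr_gt0; [rewrite sqrtr_gt0 !mulr_gt0 ?pi_gt0|rewrite divr_gt0].
Qed.

Lemma house_density_sym (Wp : R -> T -> R -> R) (em ep : R -> R) (b t y : R) :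
  house_density P B Wp em ep b (1 - t) (b - y) =
  house_density P B Wp em ep b t y.
Proof. by rewrite /house_density !subKr mulrAC. Qed.

(** A density integrates to 1. This rules out that a constant factor in front of
    it vanishes. *)
Lemma has_density_neq0 (b : R) (Z : T -> R -> R) (f : R -> R -> R) :
  has_density P b Z f -> ~ (forall t y, f t y = 0).
Proof.
move=> dens f0; have := dens (1 / 2) ltac:(lra) setT measurableT.
rewrite (_ : mkset _ = setT)// probability_setT integral0_eq.
  by move=> /eqP; rewrite onee_eq0.
by move=> y _; rewrite f0.
Qed.

Lemma Eexp_cst (c s t : R) (Y : T -> R -> R) : s <= t ->
  Eexp P (cst c) s t Y = expR (- (1 / 2) * (c ^+ 2 * (t - s))).
Proof.
move=> st; rewrite /Eexp /Ex.
have NE w : N (cst c) s t w = c ^+ 2 * (t - s).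
  rewrite /N /Rintegral; under eq_integral do rewrite derive1_cst add0r /=.
  rewrite integral_cst//= lebesgue_measure_itv/= lte_fin.
  case: ifPn => [_|]; first by rewrite -EFinD -EFinM.
  by rewrite -leNgt => ts; rewrite mule0 (le_anti (introT andP (conj st ts))) subrr mulr0.
under [X in expectation _ X]eq_fun do rewrite NE.
by rewrite expectation_cst.
Qed.

End HouseMoving.

(** * Space-time reversal *)

Theorem corollary4
  (R : realType) (d : measure_display) (T : measurableType d)
  (P : probability T R)
  (mu : R -> R) (mu_C1 : C1 mu)
  (b : R) (b_gt0 : 0 < b)
  (em ep : R -> R)
  (em_gt0 : forall e : R, 0 < e -> 0 < em e) (em_cvg : em e @[e --> 0^'+] --> 0)
  (ep_gt0 : forall e : R, 0 < e -> 0 < ep e) (ep_cvg : ep e @[e --> 0^'+] --> 0)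
  (B : 'I_3 -> T -> R -> R) (B_bm : brownian_motion P 3 B)
  (Wp : R -> T -> R -> R)
  (Wp_meander : forall s : R, 0 < s -> brownian_meander P s (Wp s))
  (WL WR : R -> R -> T -> R -> R)
  (WL_lim : forall t y : R, 0 < t < 1 -> 0 < y < b ->
     weak_limit P 0 t (bridge (B ord0) 0 t 0 y)
       (fun e => K 0 t (fun=> - e) (fun=> b + e)) (WL t y))
  (WR_lim : forall t y : R, 0 < t < 1 -> 0 < y < b ->
     weak_limit P t 1 (bridge (B ord0) t 1 y b)
       (fun e => K t 1 (fun=> - e) (fun=> b + e)) (WR t y))
  (H : T -> R -> R)
  (H_house : house_moving P b em ep (bridge (B ord0) 0 1 0 b) H)
  (H_density : has_density P b H (house_density P B Wp em ep b))
  (X Xb : T -> R -> R)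
  (X_diff : diffusion mu (B ord0) X)
  (Xb_bridge : diffusion_bridge P b X Xb)
  (Hmu : T -> R -> R)
  (Hmu_house : house_moving P b em ep Xb Hmu)
  (Hmu_density : has_density P b Hmu (dhouse_density P mu B Wp em ep WL WR H b)) :
  (space_time_reversal P b Hmu (dhouse_density P mu B Wp em ep WL WR H b) <->
   forall t y : R, 0 < t < 1 -> 0 < y < b ->
     Eexp P mu 0 t (WL t y) * Eexp P mu t 1 (WR t y) =
     Eexp P mu 0 (1 - t) (WL (1 - t) (b - y))
     * Eexp P mu (1 - t) 1 (WR (1 - t) (b - y)))
  /\
  ((exists c, forall x, mu x = c) ->
   space_time_reversal P b Hmu (dhouse_density P mu B Wp em ep WL WR H b)).
Proof.
set f := dhouse_density _ _ _ _ _ _ _ _ _ _.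
have const_neq0 : (house_const P (B ord0) em ep b)^-1 != 0.
  apply/eqP => c0; apply: (has_density_neq0 P _ _ _ H_density) => t y.
  by rewrite /house_density c0 !mul0r.
have EH_neq0 : (Eexp P mu 0 1 H)^-1 != 0.
  apply/eqP => E0; apply: (has_density_neq0 P _ _ _ Hmu_density) => t y.
  by rewrite /dhouse_density E0 mulr0 mul0r.
have density_neq0 t y : 0 < t < 1 -> 0 < y < b ->
    house_density P B Wp em ep b t y != 0.
  move=> /andP[t0 t1] /andP[y0 yb].
  have q_neq0 s z : 0 < s -> 0 < z < b -> house_q P B Wp b s z != 0.
    by move=> s0 zb; rewrite gt_eqF// house_q_gt0//; exact: Wp_meander.
  have q_t : house_q P B Wp b t y != 0 by rewrite q_neq0// y0.
  have q_1t : house_q P B Wp b (1 - t) (b - y) != 0.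
    by rewrite q_neq0 ?subr_gt0// gtrBl y0 yb.
  have sqrt_neq0 x : 0 < x -> (Num.sqrt x)^-1 != 0.
    by move=> x0; rewrite gt_eqF// invr_gt0 sqrtr_gt0.
  apply: mulf_neq0; apply: mulf_neq0 => //; last by rewrite sqrt_neq0 ?subr_gt0.
  by apply: mulf_neq0 => //; exact: sqrt_neq0.
have reversal_iff : space_time_reversal P b Hmu f <->
    forall t y : R, 0 < t < 1 -> 0 < y < b ->
      Eexp P mu 0 t (WL t y) * Eexp P mu t 1 (WR t y) =
      Eexp P mu 0 (1 - t) (WL (1 - t) (b - y))
      * Eexp P mu (1 - t) 1 (WR (1 - t) (b - y)).
  split=> [[_ sym] t y t01 yb|prod_sym].
    have := sym t y t01 yb; rewrite /f /dhouse_density house_density_sym.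
    by move=> /(mulIf (density_neq0 t y t01 yb)) /(mulIf EH_neq0).
  split=> // t y t01 yb.
  by rewrite /f /dhouse_density house_density_sym prod_sym.
split=> // -[c mu_c]; apply/reversal_iff => t y /andP[t0 t1] _.
have -> : mu = cst c by apply/funext.
(* Both sides are exp (- c ^ 2 / 2): only the total length 1 matters. *)
rewrite !Eexp_cst; try lra.
rewrite -!expRD; congr expR; ring.
Qed.
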